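(* For all integers $n\geq 0$, $$a_{1^{2}3^{2}4^{-3}}(4n)>0,\quad a_{1^{2}3^{2}4^{-3}}(4n+1)<0,\quad a_{1^{2}3^{2}4^{-3}}(4n+2)<0,\quad a_{1^{2}3^{2}4^{-3}}(4n+3)=0.$$
   Context: For $|q|<1$ (or as formal power series in $q$) let $f_j:=(q^j;q^j)_\infty=\prod_{k\ge 1}(1-q^{jk})$ for each positive integer $j$. The integers $a_{1^{2}3^{2}4^{-3}}(n)$, $n\ge 0$, are defined by $\sum_{n=0}^\infty a_{1^{2}3^{2}4^{-3}}(n)q^n=\dfrac{f_1^2f_3^2}{f_4^3}$. *)

(* Defs.v *)
From mathcomp Require Import all_boot all_order all_algebra.

Set Implicit Arguments.
Unset Strict Implicit.
Unset Printing Implicit Defensive.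

Import GRing.Theory.
Local Open Scope ring_scope.

(* A formal power series over R is its coefficient sequence nat -> R. *)

Definition fps_one (R : comUnitRingType) : nat -> R := fun n => (n == 0%N)%:R.

Definition fps_mul (R : comUnitRingType) (u v : nat -> R) : nat -> R :=
  fun n => \sum_(i < n.+1) u i * v (n - i)%N.

Definition fps_exp (R : comUnitRingType) (u : nat -> R) (m : nat) : nat -> R :=
  iter m (fps_mul u) (fps_one R).

(* The first n coefficients of 1 / u, obtained by solving w * u = 1 for w one
   coefficient at a time. *)
Fixpoint fps_inv_seq (R : comUnitRingType) (u : nat -> R) (n : nat) : seq R :=
  if n is m.+1 then
    let w := fps_inv_seq u m in
    rcons w ((u 0%N)^-1 * (fps_one R m - \sum_(i < m) w`_i * u (m - i)%N))
  else [::].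

(* Meaningful when u 0 is a unit; see fps_mulVf. *)
Definition fps_inv (R : comUnitRingType) (u : nat -> R) : nat -> R :=
  fun n => (fps_inv_seq u n.+1)`_n.

Definition fps_div (R : comUnitRingType) (u v : nat -> R) : nat -> R :=
  fps_mul u (fps_inv v).

(* f_j = (q^j; q^j)_oo for j > 0: for k > n the factor 1 - q^(jk) does not
   affect the coefficient of q^n; see qprod_stable. *)
Definition qprod (j : nat) : nat -> int :=
  fun n => (\prod_(1 <= k < n.+1) (1 - 'X^(j * k)) : {poly int})`_n.

Definition a_coef : nat -> int :=
  fps_div (fps_mul (fps_exp (qprod 1) 2) (fps_exp (qprod 3) 2))
          (fps_exp (qprod 4) 3).

Lemma size_fps_inv_seq (R : comUnitRingType) (u : nat -> R) n :
  size (fps_inv_seq u n) = n.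
Proof. by elim: n => //= n IHn; rewrite size_rcons IHn. Qed.

Lemma nth_fps_inv_seq (R : comUnitRingType) (u : nat -> R) n i :
  (i < n)%N -> (fps_inv_seq u n)`_i = fps_inv u i.
Proof.
elim: n => // n IHn; rewrite ltnS leq_eqVlt => /predU1P[-> //|lt_in].
by rewrite /= nth_rcons size_fps_inv_seq lt_in IHn.
Qed.

Lemma fps_mulVf (R : comUnitRingType) (u : nat -> R) :
  u 0%N \is a GRing.unit -> fps_mul (fps_inv u) u =1 fps_one R.
Proof.
move=> u0 n; rewrite /fps_mul big_ord_recr /= subnn.
rewrite {2}/fps_inv /= nth_rcons size_fps_inv_seq ltnn eqxx.
rewrite mulrAC mulVr // mul1r addrC.
under eq_bigr => i _ do rewrite nth_fps_inv_seq //.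
exact: subrK.
Qed.

Lemma qprod_stable (j n N : nat) : (0 < j)%N -> (n <= N)%N ->
  (\prod_(1 <= k < N.+1) (1 - 'X^(j * k)) : {poly int})`_n = qprod j n.
Proof.
move=> j0; elim: N => [|N IHN]; first by rewrite leqn0 => /eqP ->.
rewrite leq_eqVlt => /predU1P[-> //|lt_nN].
rewrite big_nat_recr //= mulrBr mulr1 coefB coefMXn.
by rewrite (leq_trans lt_nN (leq_pmull _ j0)) subr0 IHN.
Qed.

(* Main.v *)
(* With Ramanujan's theta functions phi(q) = sum_n q^(n^2) and
   psi(q) = sum_(n >= 0) q^(n (n + 1) / 2), Gauss's identities
     f_1^2 = f_2 phi(-q),   f_2^2 = f_1 psi(q),   f_1 f_4 = f_2 psi(-q)
   reduce f_1^2 f_3^2 to theta functions. The splitting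
   phi(q) = phi(q^4) + 2 q psi(q^8) and the identity
     psi(q) psi(q^3) = psi(q^4) phi(q^6) + q phi(q^2) psi(q^12)
   give
     f_1^2 f_3^2 = f_2 f_6 A(q^4) - 2 q f_4^2 f_12^2,
     f_1 f_3 f_4 f_12 = f_2 f_6 (psi(q^4) phi(q^6) - q phi(q^2) psi(q^12)),
   where A(q) = phi(q) phi(q^3) + 4 q psi(q^2) psi(q^6). Replacing q by q^2 in the
   second and substituting it in the first yields the 4-dissection
     f_1^2 f_3^2 / f_4^3 = D_0(q^4) - 2 q D_1(q^4) - q^2 D_2(q^4),
   with D_1 = f_3^2 / f_1 and
     D_0 = A psi(q^2) phi(q^3) f_3 / (f_1^2 f_2 f_6),
     D_2 = A phi(q) psi(q^6) f_3 / (f_1^2 f_2 f_6).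
   In D_0 and D_2 every factor is nonnegative, f_3 / f_1 being the inverse of the
   product of the 1 - q^k with 3 not dividing k, and 1 / f_1 is positive. The
   positivity of D_1 = (q^3; q^3) / ((q; q^3) (q^2; q^3)) follows from the recurrence
     R(a, z) = R(a, q^3 z) + z R(q^3 a, z),
     R(a, z) = (a z; q^3) / ((a; q^3) (z; q^3)). *)

From HB Require Import structures.
Require Import Defs.
From mathcomp Require Import all_boot all_order all_algebra.
From mathcomp Require Import boolp zify ring.

Set Implicit Arguments.
Unset Strict Implicit.
Unset Printing Implicit Defensive.

Import Order.TTheory GRing.Theory Num.Theory.
Local Open Scope ring_scope.

(** * The ring of formal power series *)

(** The record gives the sequences a type of their own, to which the ring structure with the Cauchy
    product is attached. *)
Record fps := Fps { coef_fps :> nat -> int }.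

HB.instance Definition _ := gen_eqMixin fps.
HB.instance Definition _ := gen_choiceMixin fps.

Lemma fpsP (u v : fps) : u =1 v -> u = v.
Proof. by case: u v => [u] [v] /= /funext ->. Qed.

Definition fadd (u v : fps) := Fps (fun n => u n + v n).
Definition fopp (u : fps) := Fps (fun n => - u n).
Definition fmul (u v : fps) := Fps (fps_mul u v).
Definition fpoly (p : {poly int}) := Fps (fun n => p`_n).

Lemma faddA : associative fadd.
Proof. by move=> u v w; apply: fpsP => n /=; rewrite addrA. Qed.
Lemma faddC : commutative fadd.
Proof. by move=> u v; apply: fpsP => n /=; rewrite addrC. Qed.
Lemma fadd0 : left_id (fpoly 0) fadd.
Proof. by move=> u; apply: fpsP => n /=; rewrite coef0 add0r. Qed.
Lemma faddN : left_inverse (fpoly 0) fopp fadd.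
Proof. by move=> u; apply: fpsP => n /=; rewrite coef0 addNr. Qed.

HB.instance Definition _ := GRing.isZmodule.Build fps faddA faddC fadd0 faddN.

(** Congruence modulo [q ^ M]. *)
Definition eqm (M : nat) (u v : fps) := forall n, (n < M)%N -> u n = v n.

Lemma eqm_sym M u v : eqm M u v -> eqm M v u.
Proof. by move=> h n /h. Qed.

Lemma eqm_trans M u v w : eqm M u v -> eqm M v w -> eqm M u w.
Proof. by move=> h k n lt; rewrite h // k. Qed.

Lemma fmul_eqm M (u u' v v' : fps) :
  eqm M u u' -> eqm M v v' -> eqm M (fmul u v) (fmul u' v').
Proof.
move=> eu ev n lt_nM; apply: eq_bigr => i _.
by rewrite eu ?ev //; have := ltn_ord i; lia.
Qed.

Definition trunc M (u : fps) : fps := fpoly (\poly_(i < M) u i).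

Lemma trunc_eqm M u : eqm M (trunc M u) u.
Proof. by move=> n lt; rewrite /= coef_poly lt. Qed.

Lemma fpolyM p r : fpoly (p * r) = fmul (fpoly p) (fpoly r).
Proof. by apply: fpsP => n /=; rewrite coefM. Qed.

(** A coefficient of a product depends on finitely many coefficients of the factors, so the law is
    inherited from [{poly int}] through truncations. The next two laws follow in the same way. *)
Lemma fmulA : associative fmul.
Proof.
move=> u v w; apply: fpsP => n; have lt := ltnSn n.
rewrite -(fmul_eqm (trunc_eqm u) (fmul_eqm (trunc_eqm v) (trunc_eqm w)) lt).
rewrite -(fmul_eqm (fmul_eqm (trunc_eqm u) (trunc_eqm v)) (trunc_eqm w) lt).
by rewrite -!fpolyM mulrA.
Qed.

Lemma fmulC : commutative fmul.
Proof.
move=> u v; apply: fpsP => n; have lt := ltnSn n.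
rewrite -(fmul_eqm (trunc_eqm u) (trunc_eqm v) lt).
by rewrite -(fmul_eqm (trunc_eqm v) (trunc_eqm u) lt) -!fpolyM mulrC.
Qed.

Lemma fmul1 : left_id (fpoly 1) fmul.
Proof.
move=> u; apply: fpsP => n; have lt := ltnSn n.
rewrite -(fmul_eqm (u := fpoly 1) (fun _ _ => erefl) (trunc_eqm u) lt) -fpolyM mul1r.
exact: trunc_eqm lt.
Qed.

Lemma fmulDl : left_distributive fmul fadd.
Proof.
move=> u v w; apply: fpsP => n /=; rewrite -big_split.
by apply: eq_bigr => i _; rewrite /= mulrDl.
Qed.

Lemma fone_neq0 : fpoly 1 != 0 :> fps.
Proof. by apply/eqP => /(congr1 (fun u : fps => u 0%N)) /=; rewrite coef1 coef0. Qed.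

HB.instance Definition _ := GRing.Zmodule_isComNzRing.Build fps
  fmulA fmulC fmul1 fmulDl fone_neq0.

Lemma fcoefD u v n : (u + v : fps) n = u n + v n. Proof. by []. Qed.
Lemma fcoefN u n : (- u : fps) n = - u n. Proof. by []. Qed.
Lemma fcoefB u v n : (u - v : fps) n = u n - v n. Proof. by []. Qed.
Lemma fcoef0 n : (0 : fps) n = 0. Proof. exact: coef0. Qed.
Lemma fcoef1 n : (1 : fps) n = (n == 0%N)%:R. Proof. exact: coef1. Qed.
Lemma fcoefM u v n : (u * v : fps) n = \sum_(i < n.+1) u i * v (n - i)%N.
Proof. by []. Qed.
Lemma fcoefM0 u v : (u * v : fps) 0%N = u 0%N * v 0%N.
Proof. by rewrite fcoefM big_ord1. Qed.

Definition funit : pred fps := fun u => u 0%N \is a GRing.unit.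
(** Non-units are sent to themselves, as the interface of unit rings demands. *)
Definition finv (u : fps) : fps := if funit u then Fps (fps_inv u) else u.

Lemma fmulV : {in funit, left_inverse 1 finv *%R}.
Proof.
move=> u u0; have {}u0 : funit u by [].
apply: fpsP => n; rewrite /finv u0.
by rewrite [LHS](fps_mulVf u0) fcoef1.
Qed.

Lemma funit_intro (u v : fps) : v * u = 1 -> funit u.
Proof.
move=> /(congr1 (fun u : fps => u 0%N)); rewrite fcoefM0 fcoef1 => h.
by apply/unitrP; exists (v 0%N); split=> //; rewrite mulrC.
Qed.

Lemma finv_out : {in [predC funit], finv =1 id}.
Proof. by move=> u nu; have {nu} : ~~ funit u by []; rewrite /finv => /negbTE ->. Qed.

HB.instance Definition _ := GRing.ComNzRing_hasMulInverse.Build fps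
  fmulV funit_intro finv_out.

Lemma fps_unitE (u : fps) : (u \is a GRing.unit) = (u 0%N \is a GRing.unit).
Proof. by []. Qed.

Lemma fps_invE (u : fps) : u \is a GRing.unit -> u^-1 = Fps (fps_inv u).
Proof. by rewrite fps_unitE => h; rewrite /GRing.inv /= /finv /funit h. Qed.

(** * Substitutions and infinite products *)

Lemma eqm_eq (u v : fps) : (forall M, eqm M u v) -> u = v.
Proof. by move=> h; apply: fpsP => n; apply: (h n.+1). Qed.

Lemma eqmW M M' u v : (M' <= M)%N -> eqm M u v -> eqm M' u v.
Proof. by move=> le h n lt; apply: h; apply: leq_trans le. Qed.

Lemma eqmD M (u u' v v' : fps) :
  eqm M u u' -> eqm M v v' -> eqm M (u + v) (u' + v').
Proof. by move=> eu ev n lt; rewrite !fcoefD eu ?ev. Qed.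

Lemma eqmM M (u u' v v' : fps) :
  eqm M u u' -> eqm M v v' -> eqm M (u * v) (u' * v').
Proof. exact: fmul_eqm. Qed.

Lemma fpoly_additive : zmod_morphism fpoly.
Proof. by move=> p r; apply: fpsP => n; rewrite fcoefB /= coefB. Qed.
Lemma fpoly_monoid : monoid_morphism fpoly.
Proof. by split=> // p r; apply: fpolyM. Qed.
HB.instance Definition _ := GRing.isZmodMorphism.Build _ _ fpoly fpoly_additive.
HB.instance Definition _ := GRing.isMonoidMorphism.Build _ _ fpoly fpoly_monoid.

Definition q : fps := fpoly 'X.

Lemma coef_qX k n : (q ^+ k) n = (n == k)%:R.
Proof. by rewrite -rmorphXn /= coefXn. Qed.

Lemma coef_qXM k (u : fps) n : (q ^+ k * u) n = if (n < k)%N then 0 else u (n - k)%N.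
Proof.
rewrite fcoefM; case: ltnP => [lt|le].
  by rewrite big1 // => i _; rewrite coef_qX ltn_eqF ?mul0r //; have := ltn_ord i; lia.
rewrite (bigD1 (inord k)) //= coef_qX inordK ?ltnS // eqxx mul1r big1 ?addr0 //.
move=> i; rewrite -val_eqE /= inordK ?ltnS // coef_qX => /negbTE ->.
by rewrite mul0r.
Qed.

Lemma eqm_qX M k (u : fps) : (M <= k)%N -> eqm M (q ^+ k * u) 0.
Proof. by move=> le n lt; rewrite coef_qXM fcoef0 (leq_trans lt le). Qed.

(* For [j > 0] the substitution [q -> q^j]; for [j = 0] the constant term. *)
Definition dil j (u : fps) := Fps (fun n => if (j %| n)%N then u (n %/ j)%N else 0).

Lemma dilE j u n : dil j u n = if (j %| n)%N then u (n %/ j)%N else 0.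
Proof. by []. Qed.

Lemma dil_additive j : zmod_morphism (dil j).
Proof. by move=> u v; apply: fpsP => n; rewrite fcoefB /=; case: ifP => //; rewrite subr0. Qed.

(** For [j > 0], truncation reduces multiplicativity to that of polynomial composition with ['X^j];
    for [j = 0] it is that of the constant term. *)
Lemma dil_monoid j : monoid_morphism (dil j).
Proof.
split=> [|u v]; apply: fpsP => n.
  rewrite fcoef1 [LHS]/= coef1; case: dvdnP => [[k ->]|h].
    case: j => [|j]; first by rewrite muln0.
    by rewrite mulnK // muln_eq0 orbF.
  by case: eqP => // n0; case: h; exists 0%N; rewrite n0.
have [->|j_gt0] := posnP j.
  rewrite dilE dvd0n divn0; case: eqP => [->|n0].
    by rewrite !fcoefM0 !dilE dvd0n.
  rewrite fcoefM big1 // => -[[|i] lt] _; rewrite !dilE; last by rewrite mul0r.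
  by rewrite !dvd0n subn0 (introF eqP n0) mulr0.
have lt := ltnSn n.
pose p := \poly_(i < n.+1) u i; pose r := \poly_(i < n.+1) v i.
have E (w : fps) : eqm n.+1 (fpoly ((\poly_(i < n.+1) w i) \Po 'X^j)) (dil j w).
  move=> k ltk; rewrite /= coef_comp_poly_Xn //; case: ifP => // dk.
  by rewrite coef_poly ifT // (leq_ltn_trans (leq_div _ _) ltk).
rewrite -(eqmM (E u) (E v) lt) -rmorphM -comp_polyM /= coef_comp_poly_Xn //.
case: ifP => // _; have lt' : (n %/ j < n.+1)%N by rewrite ltnS leq_div.
have lk := leqnn (n %/ j).+1.
rewrite -[RHS]/(fpoly (p * r) (n %/ j)%N) rmorphM.
apply: (eqmM (M := (n %/ j).+1) _ _ lk) => k lk'.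
- by rewrite /= coef_poly (leq_trans lk' lt').
- by rewrite /= coef_poly (leq_trans lk' lt').
Qed.

HB.instance Definition _ j :=
  GRing.isZmodMorphism.Build _ _ (dil j) (dil_additive j).
HB.instance Definition _ j :=
  GRing.isMonoidMorphism.Build _ _ (dil j) (dil_monoid j).

Lemma dil_dil i j u : dil i (dil j u) = dil (i * j) u.
Proof.
apply: fpsP => n /=; have [->|i_gt0] := posnP i.
  by rewrite mul0n !dvd0n !divn0 div0n dvdn0.
case: (boolP (i %| n)%N) => [/dvdnP[k ->]|ndvd].
  by rewrite mulnK // [(k * i)%N]mulnC dvdn_pmul2l // divnMl.
by case: ifP => // /(dvdn_trans (dvdn_mulr j (dvdnn i))) dvd; rewrite dvd in ndvd.
Qed.

Lemma dil_qX j k : (0 < j)%N -> dil j (q ^+ k) = q ^+ (j * k).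
Proof.
move=> j_gt0; apply: fpsP => n; rewrite /= !coef_qX.
case: (boolP (j %| n)%N) => [/dvdnP[i ->]|/negP ndvd].
  by rewrite mulnK // [(i * j)%N]mulnC eqn_pmul2l.
by case: eqP => // nE; case: ndvd; rewrite nE dvdn_mulr.
Qed.

Lemma dil_eqm j M u v : eqm M u v -> eqm M (dil j u) (dil j v).
Proof.
by move=> h n lt /=; case: ifP => // _; apply: h; apply: leq_ltn_trans (leq_div _ _) lt.
Qed.

(** The substitution [q -> -q]. *)
Definition alt (u : fps) := Fps (fun n => (-1) ^+ n * u n).

Lemma altE u n : alt u n = (-1) ^+ n * u n.
Proof. by []. Qed.

Lemma alt_additive : zmod_morphism alt.
Proof. by move=> u v; apply: fpsP => n; rewrite fcoefB !altE fcoefB mulrBr. Qed.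

Lemma alt_monoid : monoid_morphism alt.
Proof.
split=> [|u v]; apply: fpsP => n.
  by rewrite altE fcoef1; case: n => [|n]; rewrite ?mulr1 ?mulr0.
rewrite altE fcoefM big_distrr; apply: eq_bigr => i _ /=.
by rewrite mulrACA -exprD subnKC // -ltnS.
Qed.

HB.instance Definition _ := GRing.isZmodMorphism.Build _ _ alt alt_additive.
HB.instance Definition _ := GRing.isMonoidMorphism.Build _ _ alt alt_monoid.

Lemma alt_q : alt q = - q.
Proof.
apply: fpsP => n; rewrite fcoefN altE -[q]expr1 coef_qX.
by case: eqP => [->|_]; rewrite ?mulr0 ?oppr0.
Qed.

Lemma alt_dil_even j u : ~~ odd j -> alt (dil j u) = dil j u.
Proof.
move=> ej; apply: fpsP => n /=; case: ifP => [/dvdnP[k ->]|_]; last by rewrite mulr0.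
by rewrite -signr_odd oddM (negbTE ej) andbF mul1r.
Qed.

Lemma alt_dil_odd j u : odd j -> alt (dil j u) = dil j (alt u).
Proof.
move=> oj; apply: fpsP => n /=; case: ifP => [/dvdnP[k ->]|_]; last by rewrite mulr0.
by rewrite mulnK ?odd_gt0 // -signr_odd oddM oj andbT signr_odd.
Qed.

Lemma alt_eqm M u v : eqm M u v -> eqm M (alt u) (alt v).
Proof. by move=> h n lt; rewrite /= h. Qed.

(* The [k]-th factor is [1 + O(q^(k+1))], so that the infinite product converges. *)
Definition tame (a : nat -> fps) := forall k, eqm k.+1 (a k) 1.

Definition iprod (a : nat -> fps) := Fps (fun n => (\prod_(k < n.+1) a k) n).

Lemma iprod_eqm a M M' : tame a -> (M <= M')%N -> eqm M (iprod a) (\prod_(k < M') a k).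
Proof.
move=> ta le n lt /=; have {le lt} : (n < M')%N by apply: leq_trans le.
elim: M' => // M' IH; rewrite ltnS leq_eqVlt => /predU1P[->//|lt].
rewrite [in RHS]big_ord_recr IH // -[X in coef_fps X n = _]mulr1.
apply: (eqmM (M := n.+1)) => //; apply: eqm_sym; apply: eqmW (ta M').
by rewrite ltnS ltnW.
Qed.

(** For each precision [M] some partial product with at least [M] factors suffices. This freedom in
    [M'] serves shifted products. *)
Lemma iprod_unique a u : tame a ->
  (forall M, exists2 M', (M <= M')%N & eqm M u (\prod_(k < M') a k)) -> u = iprod a.
Proof.
move=> ta h; apply: eqm_eq => M; have [M' le eu] := h M.
exact: eqm_trans eu (eqm_sym (iprod_eqm ta le)).
Qed.

Lemma eq_iprod a b : a =1 b -> iprod a = iprod b.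
Proof.
by move=> e; apply: fpsP => n /=; congr (coef_fps _ n); apply: eq_bigr.
Qed.

Lemma tameM a b : tame a -> tame b -> tame (fun k => a k * b k).
Proof. by move=> ta tb k; rewrite -[1]mulr1; apply: eqmM. Qed.

Lemma iprodM a b : tame a -> tame b ->
  iprod (fun k => a k * b k) = iprod a * iprod b.
Proof.
move=> ta tb; symmetry; apply: iprod_unique; first exact: tameM.
move=> M; exists M => //; rewrite big_split /=.
by apply: eqmM; apply: iprod_eqm.
Qed.

Lemma iprod_recl a : tame a -> iprod a = a 0%N * iprod (fun k => a k.+1).
Proof.
move=> ta; symmetry; apply: iprod_unique => // M; exists M.+1 => //.
rewrite big_ord_recl; apply: eqmM => //; apply: iprod_eqm => // k.
exact: (eqmW (leqnSn _) (ta k.+1)).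
Qed.

Lemma tame_group m a : tame a -> (0 < m)%N -> tame (fun k => \prod_(i < m) a (k * m + i)%N).
Proof.
move=> ta m_gt0 k; elim/big_ind: _ => // [u v eu ev|i _].
  by rewrite -[1]mulr1; apply: eqmM.
by apply: eqmW (ta _); rewrite ltnS; nia.
Qed.

Lemma iprod_group m a : tame a -> (0 < m)%N ->
  iprod a = iprod (fun k => \prod_(i < m) a (k * m + i)%N).
Proof.
move=> ta m_gt0; apply: iprod_unique; first exact: tame_group.
move=> M; exists M => //.
suff -> : \prod_(k < M) \prod_(i < m) a (k * m + i)%N = \prod_(k < M * m) a k.
  by apply: iprod_eqm => //; apply: leq_pmulr.
elim: M => [|M IH]; first by rewrite !big_ord0.
by rewrite big_ord_recr IH mulSnr big_split_ord.
Qed.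

Lemma dil_iprod j a : tame a -> dil j (iprod a) = iprod (fun k => dil j (a k)).
Proof.
move=> ta; apply: iprod_unique => [k|M].
  by rewrite -(rmorph1 (dil j)); apply: dil_eqm.
by exists M => //; rewrite -rmorph_prod; apply: dil_eqm; apply: iprod_eqm.
Qed.

Lemma alt_iprod a : tame a -> alt (iprod a) = iprod (fun k => alt (a k)).
Proof.
move=> ta; apply: iprod_unique => [k|M].
  by rewrite -(rmorph1 alt); apply: alt_eqm.
by exists M => //; rewrite -rmorph_prod; apply: alt_eqm; apply: iprod_eqm.
Qed.

(* The infinite product [(q^a; q^m)_oo]. *)
Definition poch a m := iprod (fun k => 1 - q ^+ (a + k * m)).

Lemma tame_qX (c : nat -> nat) : (forall k, k < c k)%N -> tame (fun k => 1 - q ^+ c k).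
Proof.
move=> h k n lt; rewrite fcoefB coef_qX ltn_eqF ?subr0 //.
exact: leq_trans (h k).
Qed.

Lemma tame_poch a m : (0 < a)%N -> (0 < m)%N -> tame (fun k => 1 - q ^+ (a + k * m)).
Proof. by move=> a0 m0; apply: tame_qX => k; nia. Qed.

Lemma poch_recl a m : (0 < a)%N -> (0 < m)%N -> poch a m = (1 - q ^+ a) * poch (a + m) m.
Proof.
move=> a0 m0; rewrite /poch iprod_recl; last exact: tame_poch.
rewrite mul0n addn0; congr (_ * _); apply: eq_iprod => k.
by rewrite mulSn addnA.
Qed.

Lemma poch_split2 a m : (0 < a)%N -> (0 < m)%N ->
  poch a m = poch a (2 * m) * poch (a + m) (2 * m).
Proof.
move=> a0 m0; rewrite /poch (@iprod_group 2) //; last exact: tame_poch.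
rewrite -iprodM; try by apply: tame_poch; lia.
apply: eq_iprod => k; rewrite !big_ord_recl big_ord0 mulr1 /=.
by congr ((1 - q ^+ _) * (1 - q ^+ _)); rewrite /bump /=; lia.
Qed.

Lemma poch_split3 a m : (0 < a)%N -> (0 < m)%N ->
  poch a m = poch a (3 * m) * (poch (a + m) (3 * m) * poch (a + 2 * m) (3 * m)).
Proof.
move=> a0 m0; rewrite /poch (@iprod_group 3) //; last exact: tame_poch.
rewrite -iprodM; try by apply: tame_poch; lia.
rewrite -iprodM; first last.
- by apply: tameM; apply: tame_poch; lia.
- by apply: tame_poch; lia.
apply: eq_iprod => k; rewrite !big_ord_recl big_ord0 mulr1 /=.
by congr ((1 - q ^+ _) * ((1 - q ^+ _) * (1 - q ^+ _))); rewrite /bump /=; lia.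
Qed.

Lemma dil_poch j a m : (0 < j)%N -> (0 < a)%N -> (0 < m)%N ->
  dil j (poch a m) = poch (j * a) (j * m).
Proof.
move=> j0 a0 m0; rewrite /poch dil_iprod; last exact: tame_poch.
apply: eq_iprod => k; rewrite rmorphB rmorph1 /= dil_qX //.
by congr (_ - q ^+ _); lia.
Qed.

Lemma poch_coef0 a m : (0 < a)%N -> (poch a m) 0%N = 1.
Proof.
move=> a0; rewrite /= big_ord1 fcoefB fcoef1 coef_qX mul0n addn0.
by rewrite [(0 == a)%N]ltn_eqF // subr0.
Qed.

Lemma poch_unit a m : (0 < a)%N -> poch a m \is a GRing.unit.
Proof. by move=> a0; rewrite fps_unitE poch_coef0 // unitr1. Qed.

(* Euler's [f_j]. *)
Definition F j := poch j j.

Lemma qprodE j : (0 < j)%N -> qprod j =1 F j.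
Proof.
move=> j0 n; rewrite -(qprod_stable j0 (leqnSn n)) big_add1 /= big_mkord.
rewrite -[LHS]/(fpoly _ n) rmorph_prod.
rewrite -[RHS]/(iprod (fun k => 1 - q ^+ (j + k * j)) n).
rewrite (iprod_eqm (tame_poch j0 j0) (leqnn n.+1) (ltnSn n)).
congr (coef_fps _ n); apply: eq_bigr => k _.
by rewrite rmorphB rmorph1 rmorphXn mulnS mulnC.
Qed.

(** * Shanks's finite forms of Gauss's identities *)

Section Shanks.

Variables (R : comNzRingType) (x : R).

(** In Pochhammer notation [E s n] is [(x^2; x^2)_n / (x^2; x^2)_s] for [s <= n], written as a
    product over an interval to avoid division, and [O s] is [(x; x^2)_s]. *)
Let E s n := \prod_(s <= j < n) (1 - x ^+ (2 * j + 2)).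
Let O s := \prod_(j < s) (1 - x ^+ (2 * j + 1)).
Let t s n := E s n * O s * x ^+ (s * (2 * n + 1)).

(* The summands telescope. *)
Let sum_t_step m n : (m <= n)%N ->
  \sum_(s < m.+1) (t s n.+1 - (1 - x ^+ (2 * n + 1)) * t s n) =
  E m n * O m.+1 * x ^+ (m.+1 * (2 * n + 1)).
Proof.
have step s : (s <= n)%N -> t s n.+1 - (1 - x ^+ (2 * n + 1)) * t s n =
    E s n * O s * x ^+ (s * (2 * n + 1)) *
    ((1 - x ^+ (2 * s + 1)) * x ^+ (2 * n + 1) - (1 - x ^+ (2 * s))).
  move=> le; rewrite /t {1}/E big_nat_recr //= -/(E s n).
  have -> : (s * (2 * n.+1 + 1) = s * (2 * n + 1) + 2 * s)%N by lia.
  have -> : (2 * n + 2 = (2 * n + 1) + 1)%N by lia.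
  by rewrite !exprD; ring.
elim: m => [_|m IH lt]; rewrite big_ord_recr /= step //.
  rewrite big_ord0 /O big_ord0 big_ord_recr big_ord0 /= !muln0 !mul0n mul1n.
  by rewrite expr0; ring.
rewrite IH 1?ltnW // {1}/E big_ltn // -/(E m.+1 n).
have -> : O m.+2 = O m.+1 * (1 - x ^+ (2 * m.+1 + 1)) by rewrite /O big_ord_recr.
have -> : (m.+2 * (2 * n + 1) = m.+1 * (2 * n + 1) + (2 * n + 1))%N by lia.
have -> : (2 * m + 2 = 2 * m.+1)%N by lia.
by rewrite !exprD; ring.
Qed.

(** By the telescoping, passing from [n] to [n.+1] multiplies the left side by
    [1 - x ^+ (2 * n + 1)] and adds boundary terms, as it does on the right. The exponents on the
    right are the triangular numbers of indices [2 i + 1] and [2 i + 2]. *)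
Lemma Shanks_triangular n :
  \sum_(s < n.+1) t s n =
  O n * (1 + \sum_(i < n) (x ^+ (i.+1 * (2 * i + 1)) + x ^+ (i.+1 * (2 * i + 3)))).
Proof.
elim: n => [|n IH].
  by rewrite big_ord1 big_ord0 addr0 /t /E big_geq // mul0n expr0 !mulr1 mul1r.
have := sum_t_step (leqnn n); rewrite sumrB -mulr_sumr IH.
move/(canRL (subrK _)) => e; rewrite big_ord_recr /= e.
rewrite /t /E !big_geq // [in RHS]big_ord_recr /=.
have -> : O n.+1 = O n * (1 - x ^+ (2 * n + 1)) by rewrite /O big_ord_recr.
have -> : (2 * n.+1 + 1 = 2 * n + 3)%N by lia.
by ring.
Qed.

(** [P s n] is [(x; x)_n / (x; x)_s] for [s <= n], and [M s] is [(-x; x)_s]. In [r], the factor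
    [2 * M s'] is [(-1; x)_s], whose value at [s = 0] is the empty product; hence the case
    distinction. *)
Let P s n := \prod_(s <= j < n) (1 - x ^+ j.+1).
Let M s := \prod_(j < s) (1 + x ^+ j.+1).
Let r s n := P s n *
  (if s is s'.+1 then 2 * (-1) ^+ s * M s' * x ^+ (s * n.+1) else 1).

Let sum_r_step m n : (m <= n)%N ->
  \sum_(s < m.+1) (r s n.+1 - (1 + x ^+ n.+1) * r s n) =
  2 * (-1) ^+ m.+1 * P m n * M m * x ^+ (m.+1 * n.+1).
Proof.
have PS s : (s <= n)%N -> P s n.+1 = P s n * (1 - x ^+ n.+1).
  by move=> le; rewrite /P big_nat_recr.
elim: m => [_|m IH lt]; rewrite big_ord_recr /=.
  by rewrite big_ord0 /r PS // /M big_ord0 mul1n expr1; ring.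
rewrite IH 1?ltnW // /r PS // {1}/P big_ltn // -/(P m.+1 n).
have -> : M m.+1 = M m * (1 + x ^+ m.+1) by rewrite /M big_ord_recr.
have -> : (m.+1 * n.+2 = m.+1 * n.+1 + m.+1)%N by lia.
have -> : (m.+2 * n.+1 = m.+1 * n.+1 + n.+1)%N by lia.
by rewrite !exprD [(-1) ^+ m.+2]exprS; ring.
Qed.

(** The same telescoping argument, now with ratio [1 + x ^+ n.+1]. *)
Lemma Shanks_square n :
  \sum_(s < n.+1) r s n =
  M n * (1 + 2 * \sum_(i < n) (-1) ^+ i.+1 * x ^+ (i.+1 ^ 2)).
Proof.
elim: n => [|n IH].
  by rewrite big_ord1 big_ord0 mulr0 addr0 /r /M big_ord0 /P big_geq // mulr1.
have := sum_r_step (leqnn n); rewrite sumrB -mulr_sumr IH.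
move/(canRL (subrK _)) => e; rewrite big_ord_recr /= e.
rewrite /r /P !big_geq // [in RHS]big_ord_recr /=.
have -> : M n.+1 = M n * (1 + x ^+ n.+1) by rewrite /M big_ord_recr.
have -> : (n.+1 * n.+2 = n.+1 ^ 2 + n.+1)%N by lia.
rewrite mulnn exprD; ring.
Qed.

End Shanks.

(** * Theta series and their product formulas *)

(* [u] is the generating function [\sum_i q ^+ w i]. *)
Definition gf (I : eqType) (w : I -> nat) (u : fps) :=
  exists s : nat -> seq I, forall n,
    [/\ uniq (s n), forall i, (i \in s n) = (w i == n) & u n = (size (s n))%:R].

Lemma gf_unique (I : eqType) (w : I -> nat) u v : gf w u -> gf w v -> u = v.
Proof.
move=> [s hs] [t ht]; apply: fpsP => n.
have [us ms ->] := hs n; have [ut mt ->] := ht n.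
by rewrite (perm_size (uniq_perm us ut _)) // => i; rewrite ms mt.
Qed.

(** Together with [gf_unique] this turns an identity between theta series into a weight-preserving
    bijection of index sets. *)
Lemma gf_bij (I J : eqType) (w : I -> nat) (w' : J -> nat) (g : J -> I) u :
  bijective g -> (forall j, w' j = w (g j)) -> gf w u -> gf w' u.
Proof.
move=> [h hK gK] eqw [s hs]; exists (fun n => map h (s n)) => n.
have [us ms un] := hs n; split.
- by rewrite map_inj_uniq //; apply: can_inj gK.
- by move=> j; rewrite -{1}[j]hK mem_map ?ms ?eqw //; apply: can_inj gK.
- by rewrite size_map.
Qed.

Lemma gf_sum (I J : eqType) (w : I -> nat) (w' : J -> nat) u v :
  gf w u -> gf w' v ->
  gf (fun x : I + J => match x with inl i => w i | inr j => w' j end) (u + v).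
Proof.
move=> [s hs] [t ht]; exists (fun n => map inl (s n) ++ map inr (t n)) => n.
have [us ms un] := hs n; have [ut mt vn] := ht n; split.
- rewrite cat_uniq !map_inj_uniq ?us ?ut //; try by move=> ? ? [].
  by rewrite andbT /=; apply/hasPn => x /mapP[j _ ->]; apply/mapP => -[].
- case=> i; rewrite mem_cat.
    rewrite mem_map ?ms; last by move=> ? ? [].
    by rewrite orbC; case: mapP => // -[].
  rewrite mem_map ?mt; last by move=> ? ? [].
  by case: mapP => // -[].
- by rewrite fcoefD size_cat !size_map natrD un vn.
Qed.

Lemma gf_prod (I J : eqType) (w : I -> nat) (w' : J -> nat) u v :
  gf w u -> gf w' v -> gf (fun x : I * J => w x.1 + w' x.2)%N (u * v).
Proof.
(* [L n] lists the indices of weight below [n]. The pairs of total weight [n] are then found by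
   taking [i] in [L n.+1] and [j] of weight [n - w i]. *)
move=> [s hs] [t ht]; pose L n := \big[cat/[::]]_(k < n) s k.
have LS n : L n.+1 = L n ++ s n by rewrite /L big_ord_recr.
have memL n i : (i \in L n) = (w i < n)%N.
  elim: n => [|n IH]; first by rewrite /L big_ord0.
  by rewrite LS mem_cat IH; have [_ -> _] := hs n; rewrite [RHS]ltnS [RHS]leq_eqVlt orbC.
have uL n : uniq (L n).
  elim: n => [|n IH]; first by rewrite /L big_ord0.
  have [us ms _] := hs n; rewrite LS cat_uniq IH us andbT.
  by apply/hasPn => i; rewrite ms memL => /eqP ->; rewrite ltnn.
have sL (f : nat -> nat) n : (\sum_(i <- L n) f (w i) = \sum_(k < n) size (s k) * f k)%N.
  elim: n => [|n IH]; first by rewrite /L !big_ord0 big_nil.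
  rewrite LS big_cat IH big_ord_recr /=; congr addn.
  have [_ ms _] := hs n; rewrite big_seq (eq_bigr (fun=> f n)).
    by rewrite -big_seq big_const_seq count_predT iter_addn_0 mulnC.
  by move=> i; rewrite ms => /eqP ->.
exists (fun n => [seq (i, j) | i <- L n.+1, j <- t (n - w i)%N]) => n; split.
- apply: allpairs_uniq_dep => // [i _|[? ?] [? ?] _ _ /= [-> ->] //].
  by have [] := ht (n - w i)%N.
- case=> i j; apply/allpairsPdep/eqP => /=.
    move=> [i' [j' [+ + [-> ->]]]]; rewrite memL.
    by have [_ -> _] := ht (n - w i')%N => lt /eqP ->; rewrite subnKC.
  move=> e; exists i, j; rewrite memL; have [_ -> _] := ht (n - w i)%N.
  by rewrite -e ltnS leq_addr addKn eqxx.
- rewrite size_allpairs_dep sumnE big_map (sL (fun k => size (t (n - k)%N))).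
  rewrite natr_sum fcoefM; apply: eq_bigr => k _.
  by have [_ _ ->] := hs k; have [_ _ ->] := ht (n - k)%N; rewrite natrM.
Qed.

Lemma gf_qX (I : eqType) (w : I -> nat) k u :
  gf w u -> gf (fun i => k + w i)%N (q ^+ k * u).
Proof.
move=> [s hs]; exists (fun n => if (n < k)%N then [::] else s (n - k)%N) => n.
rewrite coef_qXM; case: ltnP => [lt|le]; last first.
  have [us ms un] := hs (n - k)%N; split=> // i; rewrite ms; lia.
by split=> // i; rewrite in_nil; apply/esym/negbTE; lia.
Qed.

Lemma gf_dil (I : eqType) (w : I -> nat) j u :
  (0 < j)%N -> gf w u -> gf (fun i => j * w i)%N (dil j u).
Proof.
move=> j0 [s hs]; exists (fun n => if (j %| n)%N then s (n %/ j)%N else [::]) => n.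
rewrite dilE; case: (boolP (j %| n)%N) => [/dvdnP[k ->]|/negP ndvd]; last first.
  by split=> // i; rewrite in_nil; apply/esym/negbTE/eqP => e;
    case: ndvd; rewrite -e dvdn_mulr.
by rewrite mulnK //; have [us ms un] := hs k; split=> // i; rewrite ms mulnC eqn_pmul2r.
Qed.

Definition ibox n : seq int := map Posz (iota 0 n.+1) ++ map Negz (iota 0 n).

Lemma mem_ibox n (a : int) : (a \in ibox n) = (`|a| <= n)%N.
Proof.
rewrite mem_cat; case: a => a.
  rewrite mem_map; last by move=> ? ? [].
  by rewrite mem_iota orbC; case: mapP => [[]|] //=; rewrite add0n ltnS.
rewrite (mem_map (f := Negz)); last by move=> ? ? [].
by rewrite mem_iota; case: mapP => [[]|].
Qed.

Lemma uniq_ibox n : uniq (ibox n).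
Proof.
rewrite cat_uniq !map_inj_uniq ?iota_uniq //; try by move=> ? ? [].
by rewrite andbT /=; apply/hasPn => x /mapP[j _ ->]; apply/mapP => -[].
Qed.

Lemma big_ibox n (f : int -> fps) :
  \sum_(a <- ibox n) f a = \sum_(i < n.+1) f i%:Z + \sum_(i < n) f (Negz i).
Proof.
rewrite big_cat !big_map -(big_mkord xpredT (fun i => f i%:Z)).
by rewrite -(big_mkord xpredT (fun i => f (Negz i))) /index_iota !subn0.
Qed.

(** The series of all [q ^ w a], provided [|a| <= w a]: under this bound the box [ibox n] contains
    every index of weight [n]. *)
Definition theta (w : int -> nat) :=
  Fps (fun n => (size [seq a <- ibox n | w a == n])%:R).

Lemma theta_gf w : (forall a : int, `|a| <= w a)%N -> gf w (theta w).
Proof.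
move=> hw; exists (fun n => [seq a <- ibox n | w a == n]) => n; split=> //.
  by rewrite filter_uniq // uniq_ibox.
by move=> a; rewrite mem_filter mem_ibox; case: eqP => // <-; rewrite hw.
Qed.

Lemma theta_eqm w n : (forall a : int, `|a| <= w a)%N ->
  eqm n.+1 (theta w) (\sum_(a <- ibox n) q ^+ w a).
Proof.
move=> hw k lt.
have -> : (\sum_(a <- ibox n) q ^+ w a) k = \sum_(a <- ibox n) (w a == k)%:R.
  elim: (ibox n) => [|a l IH]; first by rewrite !big_nil fcoef0.
  by rewrite !big_cons fcoefD IH coef_qX eq_sym.
rewrite -natr_sum; congr (_%:R).
have -> : (\sum_(a <- ibox n) (w a == k) = size [seq a <- ibox n | w a == k])%N.
  by rewrite size_filter -sumn_count sumnE big_map.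
apply: perm_size; apply: uniq_perm; rewrite ?filter_uniq ?uniq_ibox // => a.
rewrite !mem_filter !mem_ibox; case: eqP => //= e; have := hw a; lia.
Qed.

(* Ramanujan's theta functions: [2 a^2 + a] runs once through the triangular
   numbers as [a] runs through the integers. *)
Definition psi := theta (fun a => absz (2 * a ^+ 2 + a)).
Definition phi := theta (fun a => `|a| ^ 2)%N.

Lemma psi_weight (a : int) : (`|a| <= absz (2 * a ^+ 2 + a)%R)%N.
Proof. nia. Qed.
Lemma phi_weight (a : int) : (`|a| <= `|a| ^ 2)%N.
Proof. nia. Qed.

Lemma poch_eqm a m M M' : (0 < a)%N -> (0 < m)%N -> (M <= M')%N ->
  eqm M (poch a m) (\prod_(k < M') (1 - q ^+ (a + k * m))).
Proof. by move=> a0 m0; apply: iprod_eqm; apply: tame_poch. Qed.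

Lemma eqm_sum0 (I : Type) (s : seq I) (P : pred I) (f : I -> fps) M :
  (forall i, P i -> eqm M (f i) 0) -> eqm M (\sum_(i <- s | P i) f i) 0.
Proof.
move=> h; elim/big_ind: _ => // u v eu ev.
by rewrite -[0]addr0; apply: eqmD.
Qed.

(** The limit of [Shanks_triangular], taken modulo [q ^ n]: the right side tends to
    [poch 1 2 * psi], the summand [s = 0] to [F 2]. *)
Lemma psi_poch : psi * poch 1 2 = F 2.
Proof.
apply: eqm_eq => n; have := Shanks_triangular q n.
rewrite big_ord_recl mul0n expr0 !mulr1 big_ord0 mulr1 => sh.
have e1 : eqm n psi (1 + \sum_(i < n)
    (q ^+ (i.+1 * (2 * i + 1)) + q ^+ (i.+1 * (2 * i + 3)))).
  apply: eqmW (leqnSn n) _; apply: eqm_trans (theta_eqm psi_weight) _.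
  rewrite big_ibox big_ord_recl /= -addrA -big_split /=.
  by move=> k _; congr (coef_fps (_ + _) k); apply: eq_bigr => i _;
    rewrite addrC; congr (q ^+ _ + q ^+ _); rewrite /bump /=; lia.
apply: eqm_trans (eqmM e1 (poch_eqm _ _ (leqnn n))) _ => //.
rewrite mulrC; under eq_bigr => k _ do rewrite mulnC addnC; rewrite -sh.
rewrite -[F 2]addr0; apply: eqmD.
  apply: eqm_sym; apply: eqm_trans (poch_eqm _ _ (leqnn n)) _ => // k _.
  rewrite big_mkord; congr (coef_fps _ k); apply: eq_bigr => i _.
  by rewrite mulnC addnC.
(* The summands with [s > 0] are divisible by [q ^ (2 n + 1)]. *)
by apply: eqm_sum0 => i _; rewrite mulrC; apply: eqm_qX; rewrite /= /bump; nia.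
Qed.

Definition poch_neg := iprod (fun k => 1 + q ^+ k.+1).

Lemma tame_poch_neg : tame (fun k => 1 + q ^+ k.+1).
Proof. by move=> k n lt; rewrite fcoefD coef_qX ltn_eqF ?addr0. Qed.

Lemma poch_neg_mul : poch_neg * F 1 = F 2.
Proof.
rewrite /F [poch 2 2](_ : _ = iprod (fun k => (1 + q ^+ k.+1) * (1 - q ^+ (1 + k * 1)))).
  by rewrite iprodM //; [apply: tame_poch_neg | apply: tame_poch].
apply: eq_iprod => k; rewrite [(k * 1)%N]muln1 add1n
  (_ : (2 + k * 2 = k.+1 + k.+1)%N); last lia.
by rewrite exprD; ring.
Qed.

(** The limit of [Shanks_square]. The signs match because [a ^ 2] and [a] have the same parity. *)
Lemma alt_phi_poch_neg : alt phi * poch_neg = F 1.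
Proof.
apply: eqm_eq => n; have := Shanks_square q n.
rewrite big_ord_recl !mulr1 => sh.
have e1 : eqm n (alt phi) (1 + 2 * \sum_(i < n) (-1) ^+ i.+1 * q ^+ (i.+1 ^ 2)).
  apply: eqmW (leqnSn n) _; apply: eqm_trans (alt_eqm (theta_eqm phi_weight)) _.
  rewrite big_ibox big_ord_recl /= -addrA -big_split /= exp0n // expr0.
  rewrite rmorphD rmorph1 rmorph_sum.
  rewrite mulr_sumr; move=> k _; congr (coef_fps (_ + _) k); apply: eq_bigr => i _.
  rewrite rmorphD !rmorphXn /= alt_q /bump /= add1n.
  rewrite [(- q) ^+ _]exprNn (_ : (-1 : fps) ^+ (i.+1 ^ 2) = (-1) ^+ i.+1); first by ring.
  by rewrite -[LHS]signr_odd oddX orFb signr_odd.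
rewrite mulrC.
apply: eqm_trans (eqmM (iprod_eqm tame_poch_neg (leqnn n)) e1) _.
rewrite -sh -[F 1]addr0; apply: eqmD.
  apply: eqm_sym; apply: eqm_trans (poch_eqm _ _ (leqnn n)) _ => // k _.
  rewrite big_mkord; congr (coef_fps _ k); apply: eq_bigr => i _.
  by rewrite muln1.
apply: eqm_sum0 => i _; rewrite mulrA mulrC; apply: eqm_qX; rewrite /= /bump; nia.
Qed.

(** * Gauss's identities in terms of Euler products *)

Lemma F_poch j : (0 < j)%N -> F j = poch j (2 * j) * F (2 * j).
Proof. by move=> j0; rewrite {1}/F poch_split2 // addnn -mul2n. Qed.

Lemma F_unit j : (0 < j)%N -> F j \is a GRing.unit.
Proof. exact: poch_unit. Qed.

Lemma dil_F i j : (0 < i)%N -> (0 < j)%N -> dil i (F j) = F (i * j).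
Proof. by move=> i0 j0; rewrite /F dil_poch. Qed.

Lemma F1_sqr : F 1 ^+ 2 = F 2 * alt phi.
Proof. by rewrite expr2 -poch_neg_mul -{1}alt_phi_poch_neg; ring. Qed.

Lemma F2_sqr : F 2 ^+ 2 = F 1 * psi.
Proof. by rewrite expr2 -{1}psi_poch (F_poch (j := 1)) //; ring. Qed.

Lemma alt_poch12 : alt (poch 1 2) * poch 1 2 = poch 2 4.
Proof.
rewrite {1}/poch alt_iprod; last exact: tame_poch.
rewrite -iprodM; first last.
- exact: tame_poch.
- move=> k; rewrite -[X in eqm _ _ X](rmorph1 alt); apply: alt_eqm; exact: tame_poch.
apply: eq_iprod => k; rewrite rmorphB rmorph1 rmorphXn /= alt_q exprNn.
have -> : (-1 : fps) ^+ (1 + k * 2) = -1 by rewrite -signr_odd oddD oddM andbF.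
rewrite (_ : (2 + k * 4 = (1 + k * 2) + (1 + k * 2))%N); last lia.
by rewrite [q ^+ (_ + _ + _)]exprD; ring.
Qed.

(** Apply [q -> -q] to [psi_poch], whose right side is even, and remove the product [alt (poch 1 2)]
    by means of [alt_poch12]. *)
Lemma F1_alt_psi : F 1 * F 4 = F 2 * alt psi.
Proof.
have a2 : alt (F 2) = F 2 by rewrite -(dil_F (i := 2) (j := 1)) // alt_dil_even.
have := congr1 alt psi_poch; rewrite rmorphM /= a2 => e.
have F1 := F_poch (j := 1) isT; have F2 := F_poch (j := 2) isT.
rewrite F1 -{1}e.
transitivity (alt psi * (alt (poch 1 2) * poch 1 2 * F 4)); first by ring.
by rewrite alt_poch12 -F2; ring.
Qed.

(** * Theta function identities by bijections *)

Lemma psi_gf : gf (fun a : int => absz (2 * a ^+ 2 + a)) psi.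
Proof. exact: theta_gf psi_weight. Qed.

Lemma phi_gf : gf (fun a : int => `|a| ^ 2)%N phi.
Proof. exact: theta_gf phi_weight. Qed.

Lemma psi_weightE (a : int) : (absz (2 * a ^+ 2 + a))%:Z = 2 * a ^+ 2 + a.
Proof. by rewrite gez0_abs //; nia. Qed.

Lemma phi_weightE (a : int) : (`|a| ^ 2)%N%:Z = a ^+ 2.
Proof. by rewrite PoszM abszE -normrM ger0_norm // -expr2 sqr_ge0. Qed.

Lemma int_parity (d : int) : {k : int | d = 2 * k} + {k : int | d = 2 * k + 1}.
Proof.
case: (boolP (d %% 2 == 0)%Z) => h; [left | right]; exists (d %/ 2)%Z; lia.
Qed.

(** Even integers give [dil 4 phi]. An odd integer is [4 a + 1] or its opposite for a unique [a],
    and [(4 a + 1)^2 = 8 (2 a^2 + a) + 1], whence two copies of [q * dil 8 psi]. *)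
Lemma phi_dissection : phi = dil 4 phi + 2 * (q * dil 8 psi).
Proof.
have h4 := gf_dil (j := 4) isT phi_gf.
have h8 := gf_qX 1 (gf_dil (j := 8) isT psi_gf).
rewrite (_ : 2 * (q * dil 8 psi) = q ^+ 1 * dil 8 psi + q ^+ 1 * dil 8 psi);
  last by rewrite expr1; ring.
pose g (s : int + (int + int)) : int :=
  match s with inl a => 2 * a | inr (inl a) => 4 * a + 1 | inr (inr a) => - (4 * a + 1) end.
apply: gf_unique (gf_bij (g := g) _ _ phi_gf) (gf_sum h4 (gf_sum h8 h8)).
  exists (fun a => if (a %% 2)%Z == 0 then inl (a %/ 2)%Z
    else if (a %% 4)%Z == 1 then inr (inl (a %/ 4)%Z) else inr (inr ((- a) %/ 4)%Z)).
    case=> [a|[a|a]]; rewrite /g.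
    - by rewrite ifT; [congr inl|]; lia.
    - by rewrite ifF ?ifT; [congr (inr (inl _))| |]; lia.
    - by rewrite !ifF; [congr (inr (inr _))| |]; lia.
  by move=> a; rewrite /g; case: ifP => [|h]; last case: ifP; lia.
case=> [a|[a|a]]; apply/eqP;
  rewrite -eqz_nat !(phi_weightE, psi_weightE, PoszD, PoszM) /g; apply/eqP; ring.
Qed.

(* With [x = 4 a + 1] and [y = 4 b + 1], the exponents on the left are read off
   [x^2 + 3 y^2 = X^2 + 3 Y^2], where [X = (x + 3 y) / 2], [Y = (x - y) / 2] are
   even; the two products on the right collect [4 %| Y] and [4 %| X]. *)
Lemma psi_psi3 :
  psi * dil 3 psi = dil 4 psi * dil 6 phi + q * (dil 2 phi * dil 12 psi).
Proof.
have h0 := gf_prod psi_gf (gf_dil (j := 3) isT psi_gf).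
have h1 := gf_prod (gf_dil (j := 4) isT psi_gf) (gf_dil (j := 6) isT phi_gf).
have h2 := gf_qX 1 (gf_prod (gf_dil (j := 2) isT phi_gf) (gf_dil (j := 12) isT psi_gf)).
rewrite -[q]expr1.
(* On the left summand [Y = 4 d], and the odd number [X / 2 = 4 b + 2 d + 1] equals [4 c + 1] for
   even [d] and [- (4 c + 1)] for odd [d]. On the right summand [X = 4 d], and the odd number
   [Y / 2 = a - b] equals [- (4 c + 1)] for even [d] and [4 c + 1] for odd [d]. *)
pose g (s : (int * int) + (int * int)) : int * int :=
  match s with
  | inl (c, d) =>
      let b := if (d %% 2)%Z == 0 then c - (d %/ 2)%Z else - c - (d %/ 2)%Z - 1 in
      (b + 2 * d, b)
  | inr (d, c) =>
      if (d %% 2)%Z == 0 then let b := (d %/ 2)%Z + c in (b - 4 * c - 1, b)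
      else let b := (d %/ 2)%Z - c in (b + 4 * c + 1, b)
  end.
pose f (s : int * int) : (int * int) + (int * int) :=
  let: (a, b) := s in
  let d := ((a - b) %/ 2)%Z in
  if ((a - b) %% 2)%Z == 0 then
    inl (if (d %% 2)%Z == 0 then b + (d %/ 2)%Z else - b - (d %/ 2)%Z - 1, d)
  else inr (2 * b + d + 1, if (d %% 2)%Z == 0 then (d %/ 2)%Z else - (d %/ 2)%Z - 1).
apply: gf_unique (gf_bij (g := g) _ _ h0) (gf_sum h1 h2).
  exists f.
    case=> [[c d]|[d c]]; rewrite /g /f.
    - rewrite ifT; last by case: ifP; lia.
      by congr (inl (_, _)); case: (boolP (d %% 2 == 0)%Z) => h;
        [rewrite !ifT| rewrite !ifF| |]; lia.
    - case: (boolP (d %% 2 == 0)%Z) => h.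
        by rewrite ifF; [congr (inr (_, _)); [|rewrite ifF]|]; lia.
      by rewrite ifF; [congr (inr (_, _)); [|rewrite ifT]|]; lia.
  case=> a b; rewrite /f; case: (boolP ((a - b) %% 2 == 0)%Z) => h; rewrite /g.
    by case: (boolP (_ %% 2 == 0)%Z) => h'; congr (_, _); lia.
  by case: (boolP (_ %% 2 == 0)%Z) => h'; [rewrite ifF|rewrite ifT]; try (congr (_, _)); lia.
case=> [[c d]|[d c]]; apply/eqP;
  rewrite -eqz_nat /= !(phi_weightE, psi_weightE, PoszD, PoszM) /g;
  case: (int_parity d) => -[k ->].
- have -> : ((2 * k) %/ 2)%Z = k by lia.
  by rewrite ifT; [apply/eqP; ring | lia].
- have -> : ((2 * k + 1) %/ 2)%Z = k by lia.
  by rewrite ifF; [apply/eqP; ring | lia].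
- have -> : ((2 * k) %/ 2)%Z = k by lia.
  by rewrite ifT; [apply/eqP => /=; ring | lia].
- have -> : ((2 * k + 1) %/ 2)%Z = k by lia.
  by rewrite ifF; [apply/eqP => /=; ring | lia].
Qed.

(** * The 4-dissection *)

(* The Borwein cubic theta function [a(q)]; only the nonnegativity of its
   coefficients, plain in this form, is used. *)
Definition borwein := phi * dil 3 phi + 4 * (q * (dil 2 psi * dil 6 psi)).

Lemma dil_q j : (0 < j)%N -> dil j q = q ^+ j.
Proof. by move=> j0; rewrite -[q]expr1 dil_qX // muln1 expr1. Qed.

Lemma dil_psi_F j : (0 < j)%N -> F (2 * j) ^+ 2 = F j * dil j psi.
Proof.
move=> j0; have := congr1 (dil j) F2_sqr.
by rewrite rmorphXn rmorphM /= !dil_F // muln1 mulnC.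
Qed.

(** Expand [phi(-q) phi(-q^3)] by [phi_dissection]. The outer terms form [dil 4 borwein]; the cross
    terms form [psi(q^2) psi(q^6)] by [psi_psi3] at [q^2], which [dil_psi_F] turns into Euler
    products. *)
Lemma F1_F3_sqr :
  F 1 ^+ 2 * F 3 ^+ 2 = F 2 * F 6 * dil 4 borwein - 2 * q * (F 4 ^+ 2 * F 12 ^+ 2).
Proof.
have altE1 : alt phi = dil 4 phi - 2 * (q * dil 8 psi).
  rewrite {1}phi_dissection rmorphD rmorphM rmorphM rmorph_nat /= alt_q.
  by rewrite !alt_dil_even //; ring.
have := congr1 (dil 3) altE1.
rewrite rmorphB rmorphM rmorphM rmorph_nat /= dil_q // !dil_dil /= => altE3.
have := congr1 (dil 3) F1_sqr; rewrite rmorphXn rmorphM /= !dil_F // altE3 => ->.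
rewrite F1_sqr altE1.
have := congr1 (dil 2) psi_psi3.
rewrite rmorphM rmorphD !rmorphM /= dil_q // !dil_dil /= => e.
have -> : dil 4 borwein = dil 4 phi * dil 12 phi + 4 * (q ^+ 4 * (dil 8 psi * dil 24 psi)).
  by rewrite rmorphD !rmorphM rmorph_nat /= dil_q // !dil_dil.
rewrite (dil_psi_F (j := 2)) // (dil_psi_F (j := 6)) //.
transitivity (F 2 * F 6 * (dil 4 phi * dil 12 phi + 4 * (q ^+ 4 * (dil 8 psi * dil 24 psi)))
  - 2 * q * (F 2 * F 6 * (dil 8 psi * dil 12 phi + q ^+ 2 * (dil 4 phi * dil 24 psi)))).
  by ring.
by rewrite -e; ring.
Qed.

Lemma F1_F3 : F 1 * F 3 * (F 4 * F 12) =
  F 2 * F 6 * (dil 4 psi * dil 6 phi - q * (dil 2 phi * dil 12 psi)).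
Proof.
have := congr1 alt psi_psi3.
rewrite rmorphD !rmorphM /= alt_q alt_dil_odd // !alt_dil_even // => e.
have := congr1 (dil 3) F1_alt_psi; rewrite !rmorphM /= !dil_F // => e3.
transitivity ((F 1 * F 4) * (F 3 * F 12)); first by ring.
rewrite F1_alt_psi e3.
transitivity (F 2 * F 6 * (alt psi * dil 3 (alt psi))); first by ring.
by rewrite e; ring.
Qed.

(* Generating functions of [a (4 n)], [- a (4 n + 2)] and [- a (4 n + 1) / 2]. *)
Definition dissect0 := borwein * F 3 / (F 1 ^+ 2 * F 2 * F 6) * (dil 2 psi * dil 3 phi).
Definition dissect2 := borwein * F 3 / (F 1 ^+ 2 * F 2 * F 6) * (phi * dil 6 psi).
Definition dissect1 := F 3 ^+ 2 / F 1.

Lemma F1_F3_quotient : F 1 ^+ 2 * F 3 ^+ 2 / F 4 ^+ 3 =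
  dil 4 dissect0 - q ^+ 2 * dil 4 dissect2 - 2 * (q * dil 4 dissect1).
Proof.
have uF j : (0 < j)%N -> F j \is a GRing.unit by exact: F_unit.
have u1 : F 1 ^+ 2 * F 2 * F 6 \is a GRing.unit by rewrite !unitrM !uF.
have h0 : dissect0 * (F 1 ^+ 2 * F 2 * F 6) = borwein * F 3 * (dil 2 psi * dil 3 phi).
  by rewrite /dissect0 mulrAC divrK.
have h2 : dissect2 * (F 1 ^+ 2 * F 2 * F 6) = borwein * F 3 * (phi * dil 6 psi).
  by rewrite /dissect2 mulrAC divrK.
have h1 : dissect1 * F 1 = F 3 ^+ 2 by rewrite /dissect1 divrK ?uF.
(* The quotients enter only through [h0], [h1], [h2], which leaves a polynomial identity. *)
move: dissect0 dissect1 dissect2 h0 h1 h2 => dissect0 dissect1 dissect2 h0 h1 h2.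
have := congr1 (dil 4) h0; have := congr1 (dil 4) h1; have := congr1 (dil 4) h2.
rewrite !(rmorphM, rmorphXn) /= !dil_F // !dil_dil /= => {}h2 {}h1 {}h0.
have := congr1 (dil 2) F1_F3.
rewrite rmorphM rmorphM rmorphM rmorphM rmorphM rmorphB !rmorphM /= !dil_F //.
rewrite !dil_dil dil_q //= => e.
apply: (mulIr (unitrX 3 (uF 4%N isT))); rewrite divrK ?unitrX ?uF //.
(* The factors [F 8] and [F 24] complete [F 2 * F 6] to the left side of [e], which is [F1_F3] at
   [q^2]. *)
rewrite F1_F3_sqr; apply: (mulIr (uF 8%N isT)); apply: (mulIr (uF 24%N isT)).
move: h0 h1 h2 e; clear.
move: (F 2) (F 4) (F 6) (F 8) (F 12) (F 24) (dil 4 dissect0) (dil 4 dissect1) (dil 4 dissect2).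
move: (dil 4 borwein) (dil 8 psi) (dil 24 psi) (dil 4 phi) (dil 12 phi) q.
move=> b p8 p24 f4 f12 x F2 F4 F6 F8 F12 F24 Y0 Y1 Y2 h0 h1 h2 e.
transitivity (b * (F2 * F6 * (F8 * F24))
  - 2 * x * F4 ^+ 2 * F8 * F24 * (F12 * F12)); first by ring.
rewrite e -h1.
transitivity (F4 * (b * F12 * (p8 * f12))
 - x ^+ 2 * F4 * (b * F12 * (f4 * p24))
  - 2 * x * F4 ^+ 2 * F8 * F24 * (Y1 * F4)); first by ring.
rewrite -h0 -h2; ring.
Qed.

Lemma a_coefE : a_coef =1 F 1 ^+ 2 * F 3 ^+ 2 / F 4 ^+ 3.
Proof.
have one : fps_one int = (1 : fps) by apply: funext => n; rewrite fcoef1.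
have expE (u : fps) m : fps_exp u m = u ^+ m.
  by elim: m => [|m IH]; rewrite ?expr0 -?one // exprS /fps_exp iterS -/(fps_exp u m) IH.
move=> n; rewrite /a_coef !(funext (qprodE _)) // !expE /fps_div.
rewrite (fps_invE (u := F 4 ^+ 3)) //.
by rewrite unitrX // F_unit.
Qed.

(** * Positivity *)

Definition nneg (u : fps) := forall n, 0 <= u n.
Definition positive (u : fps) := forall n, 0 < u n.

Lemma nnegD u v : nneg u -> nneg v -> nneg (u + v).
Proof. by move=> hu hv n; apply: addr_ge0. Qed.

Lemma nnegM u v : nneg u -> nneg v -> nneg (u * v).
Proof. by move=> hu hv n; apply: sumr_ge0 => i _; apply: mulr_ge0. Qed.

Lemma nneg_nat m : nneg m%:R.
Proof.
elim: m => [|m IH]; first by move=> n; rewrite fcoef0.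
by rewrite -addn1 natrD; apply: nnegD => // n; rewrite fcoef1 ler0n.
Qed.

Lemma nneg_q : nneg q.
Proof. by move=> n; rewrite -[q]expr1 coef_qX ler0n. Qed.

Lemma nneg_dil j u : nneg u -> nneg (dil j u).
Proof. by move=> hu n; rewrite dilE; case: ifP. Qed.

Lemma nneg_theta w : nneg (theta w).
Proof. by move=> n; apply: ler0n. Qed.

(** The constant term of [u] is positive, so the first summand of the convolution is positive and
    the others are nonnegative. *)
Lemma positiveM u v : nneg u -> u \is a GRing.unit -> positive v -> positive (u * v).
Proof.
move=> hu uu hv n; rewrite fcoefM big_ord_recl subn0; apply: ltr_wpDr.
  by apply: sumr_ge0 => i _; apply: mulr_ge0 => //; apply: ltW.
apply: mulr_gt0 => //; rewrite lt0r hu andbT.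
by apply: contraTneq uu => u0; rewrite fps_unitE u0 unitr0.
Qed.

(** * Nonnegativity under division by infinite products *)

Lemma coef_1subqX k (u : fps) n :
  ((1 - q ^+ k) * u) n = u n - (if (n < k)%N then 0 else u (n - k)%N).
Proof. by rewrite mulrBl mul1r fcoefB coef_qXM. Qed.

Lemma nneg_div_1subqX M k (u : fps) : (0 < k)%N ->
  (forall n, (n < M)%N -> 0 <= ((1 - q ^+ k) * u) n) ->
  forall n, (n < M)%N -> 0 <= u n.
Proof.
move=> k0 h; elim/ltn_ind => n IH lt.
have := h n lt; rewrite coef_1subqX; case: ltnP => le; rewrite ?subr0 //.
by rewrite subr_ge0; apply: le_trans; apply: IH; lia.
Qed.

(** Modulo [q ^ M] the infinite product is a finite one, whose factors are stripped one at a
    time. *)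
Lemma nneg_div_poch a m (u v : fps) M : (0 < a)%N -> (0 < m)%N ->
  eqm M (poch a m * u) v -> (forall n, (n < M)%N -> 0 <= v n) ->
  forall n, (n < M)%N -> 0 <= u n.
Proof.
move=> a0 m0 e hv.
have strip N w : (forall n, (n < M)%N ->
    0 <= (\prod_(k < N) (1 - q ^+ (a + k * m)) * w) n) ->
    forall n, (n < M)%N -> 0 <= w n.
  elim: N w => [|N IH] w h.
    by move=> n lt; have := h n lt; rewrite big_ord0 mul1r.
  apply: (nneg_div_1subqX (k := a + N * m)); first by lia.
  by apply: IH; rewrite mulrA -(big_ord_recr N (fun k => 1 - q ^+ (a + k * m))).
apply: (strip M) => n lt.
rewrite -(eqmM (v := u) (poch_eqm a0 m0 (leqnn M)) _ lt) // e //.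
exact: hv.
Qed.

Lemma nneg_poch_inv a m : (0 < a)%N -> (0 < m)%N -> nneg (poch a m)^-1.
Proof.
move=> a0 m0 n.
apply: (@nneg_div_poch a m (poch a m)^-1 1 n.+1) => //.
  by rewrite mulrV ?poch_unit.
by move=> k _; apply: (nneg_nat 1).
Qed.

(** Multiplied by [1 - q] the series becomes [1 / (q^2; q)_oo], which is nonnegative; so the
    coefficients never decrease, and they start at 1. *)
Lemma positive_F1_inv : positive (F 1)^-1.
Proof.
pose w := (poch 2 1)^-1.
have e : (1 - q ^+ 1) * (F 1)^-1 = w.
  rewrite /F poch_recl // /w; apply: (mulIr (poch_unit 1 (a := 2) isT)).
  by rewrite mulVr ?poch_unit // mulrAC mulrV // -poch_recl // poch_unit.
have hw : nneg w by apply: nneg_poch_inv.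
elim=> [|n IH].
  have uF : F 1 \is a GRing.unit by apply: F_unit.
  have := congr1 (fun u : fps => u 0%N) (mulVr uF).
  by rewrite fcoefM0 poch_coef0 // mulr1 fcoef1 => ->.
have := hw n.+1; rewrite -e coef_1subqX /= subSS subn0 subr_ge0.
exact: lt_le_trans IH.
Qed.

Lemma poch_eqm1 a m M : (0 < m)%N -> (M <= a)%N -> eqm M (poch a m) 1.
Proof.
case: M => // M m0 le; have a0 : (0 < a)%N by lia.
apply: eqm_trans (poch_eqm a0 m0 (leqnn _)) _.
elim/big_ind: _ => // [u v eu ev|k _]; first by rewrite -[1]mulr1; apply: eqmM.
move=> n lt; rewrite fcoefB coef_qX ltn_eqF ?subr0 //; lia.
Qed.

(* [(a z; q^3) / ((a; q^3) (z; q^3))] at [a = q^(3 i + 2)], [z = q^(3 j + 1)];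
   the recurrence below, of Pascal type, makes it nonnegative. *)
Definition poch_ratio i j :=
  poch (3 * (i + j + 1)) 3 / (poch (3 * i + 2) 3 * poch (3 * j + 1) 3).

(** After the common factors are removed this is [1 - x z = (1 - z) + z (1 - x)]. *)
Lemma poch_ratio_rec i j :
  poch_ratio i j = poch_ratio i j.+1 + q ^+ (3 * j + 1) * poch_ratio i.+1 j.
Proof.
have u a : (0 < a)%N -> 1 - q ^+ a \is a GRing.unit.
  by move=> a0; rewrite fps_unitE fcoefB fcoef1 coef_qX [(0 == a)%N]ltn_eqF // subr0 unitr1.
have uP a : (0 < a)%N -> poch a 3 \is a GRing.unit by exact: poch_unit.
have E1 : poch (3 * (i + j + 1)) 3 =
    (1 - q ^+ (3 * i + 2) * q ^+ (3 * j + 1)) * poch (3 * (i + j + 2)) 3.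
  rewrite poch_recl //; last by lia.
  by rewrite -exprD; congr ((1 - q ^+ _) * poch _ _); lia.
have E2 : poch (3 * i + 2) 3 = (1 - q ^+ (3 * i + 2)) * poch (3 * i.+1 + 2) 3.
  by rewrite poch_recl //; [congr (_ * poch _ _) |]; lia.
have E3 : poch (3 * j + 1) 3 = (1 - q ^+ (3 * j + 1)) * poch (3 * j.+1 + 1) 3.
  by rewrite poch_recl //; [congr (_ * poch _ _) |]; lia.
rewrite /poch_ratio !(addnS i j) !(addSn i j) (_ : (i + j).+1 + 1 = i + j + 2)%N; last lia.
rewrite E1 E2 E3.
have ux : 1 - q ^+ (3 * i + 2) \is a GRing.unit by apply: u; lia.
have uz : 1 - q ^+ (3 * j + 1) \is a GRing.unit by apply: u; lia.
have uA : poch (3 * i.+1 + 2) 3 \is a GRing.unit by apply: uP; lia.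
have uB : poch (3 * j.+1 + 1) 3 \is a GRing.unit by apply: uP; lia.
move: (q ^+ _) (q ^+ _) (poch _ _) (poch _ _) (poch _ _) ux uz uA uB.
move=> z x p B A; clear => ux uz uA uB.
rewrite !invrM ?unitrM ?ux ?uz ?uA ?uB //.
transitivity (p * (A^-1 * (1 - x)^-1) * B^-1 * ((1 - z) / (1 - z)) +
  z * (p * A^-1 * (B^-1 * (1 - z)^-1) * ((1 - x) / (1 - x)))); first by ring.
by rewrite !mulrV //; ring.
Qed.

Lemma poch_ratio_unit i j : poch_ratio i j \is a GRing.unit.
Proof. by rewrite /poch_ratio unitrM unitrV unitrM !poch_unit // ?addn1 ?addn2 ?mulnS. Qed.

Lemma nneg_poch_ratio i j : nneg (poch_ratio i j).
Proof.
move=> n; elim/ltn_ind: n i j => n IHn i j.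
(* Here the numerator and the factor in [z] are both 1 modulo [q ^ n.+1], which leaves
   [1 / (a; q^3)_oo]. *)
have base i' j' : (n < 3 * j' + 1)%N -> 0 <= poch_ratio i' j' n.
  move=> lt; apply: (@nneg_div_poch (3 * i' + 2) 3 (poch_ratio i' j') 1 n.+1) => //; try lia.
    have uB : poch (3 * j' + 1) 3 \is a GRing.unit by apply: poch_unit; lia.
    have uA : poch (3 * i' + 2) 3 \is a GRing.unit by apply: poch_unit; lia.
    have e : poch (3 * i' + 2) 3 * poch_ratio i' j' * poch (3 * j' + 1) 3 =
        poch (3 * (i' + j' + 1)) 3.
      by rewrite [_ * poch_ratio _ _]mulrC -mulrA /poch_ratio divrK // unitrM uA.
    rewrite -[X in eqm _ X _]mulr1; apply: (@eqm_trans _ _ (poch (3 * (i' + j' + 1)) 3)).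
      by rewrite -e; apply: eqmM => //; apply: eqm_sym; apply: poch_eqm1.
    by apply: poch_eqm1; lia.
  by move=> k _; apply: (nneg_nat 1).
(* The first term of the recurrence raises [j] towards the base case; the second lowers [n] by
   [3 j + 1]. *)
have [k] := ubnP (n - j)%N.
elim: k i j => // k IHk i j lt.
case: (ltnP n (3 * j + 1)) => le; first exact: base.
rewrite poch_ratio_rec fcoefD coef_qXM ltnNge le; apply: addr_ge0.
  by apply: IHk; lia.
by apply: IHn; lia.
Qed.

(** At [j = 0] the recurrence shifts by a single [q], so the coefficient of index [n.+1] is at least
    that of index [n] for [i.+1], and induction starts from the constant term. *)
Lemma positive_poch_ratio i : positive (poch_ratio i 0).
Proof.
move=> n; elim: n i => [|n IH] i.
  rewrite lt0r nneg_poch_ratio andbT; apply: contraTneq (poch_ratio_unit i 0) => T0.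
  by rewrite fps_unitE T0 unitr0.
rewrite poch_ratio_rec fcoefD coef_qXM /= subSS subn0.
by apply: ltr_wpDl; [apply: nneg_poch_ratio | apply: IH].
Qed.

Lemma positive_dissect1 : positive dissect1.
Proof.
have e : F 1 = poch 2 3 * poch 1 3 * F 3.
  by rewrite /F (poch_split3 (a := 1)) // mulrA [poch 1 3 * _]mulrC.
suff -> : dissect1 = poch_ratio 0 0 by apply: positive_poch_ratio.
by rewrite /dissect1 e expr2 invrM ?unitrM ?poch_unit ?F_unit // mulrA mulrK ?F_unit.
Qed.

(** * Positivity of the even-indexed components *)

Lemma coef0_phi : phi 0%N = 1. Proof. by []. Qed.

Lemma nneg_psi : nneg psi. Proof. exact: nneg_theta. Qed.
Lemma nneg_phi : nneg phi. Proof. exact: nneg_theta. Qed.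

Lemma nneg_borwein : nneg borwein.
Proof.
have [p f qq] := (nneg_psi, nneg_phi, nneg_q).
by apply: nnegD; [|apply: nnegM (nneg_nat 4) _; apply: nnegM => //];
  apply: nnegM => //; apply: nneg_dil.
Qed.

Lemma borwein_unit : borwein \is a GRing.unit.
Proof.
rewrite fps_unitE fcoefD !fcoefM0 -[q]expr1 coef_qX mul0r mulr0 addr0.
by rewrite dilE dvdn0 div0n coef0_phi unitr1.
Qed.

(** One factor [F 1] absorbs [F 3], which leaves the nonnegative series [o^-1]; the inverse of the
    other supplies strict positivity. *)
Lemma positive_borwein_quotient u : nneg u -> u \is a GRing.unit ->
  positive (borwein * F 3 / (F 1 ^+ 2 * F 2 * F 6) * u).
Proof.
move=> hu uu; pose o := poch 1 3 * poch 2 3.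
have uF j : (0 < j)%N -> F j \is a GRing.unit by exact: F_unit.
have uo : o \is a GRing.unit by rewrite unitrM !poch_unit.
have e : F 1 = o * F 3 by rewrite /F (poch_split3 (a := 1)) // !mulrA.
have -> : borwein * F 3 / (F 1 ^+ 2 * F 2 * F 6) * u =
    borwein * o^-1 * (F 2)^-1 * (F 6)^-1 * u * (F 1)^-1.
  rewrite expr2 {1}e; move: (uF 1%N isT) (uF 2%N isT) (uF 3%N isT) (uF 6%N isT) uo.
  move: borwein (F 1) (F 2) (F 3) (F 6) (o) {e}; clear => b F1 F2 F3 F6 {}o u1 u2 u3 u6 uo.
  rewrite !invrM ?unitrM ?u1 ?u2 ?u3 ?u6 ?uo //.
  transitivity (b * (F3 / F3) * o^-1 / F2 / F6 * u / F1); first by ring.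
  by rewrite mulrV // mulr1.
apply: positiveM positive_F1_inv.
  apply: nnegM => //; do 3?apply: nnegM; try by apply: nneg_poch_inv.
    exact: nneg_borwein.
  by rewrite /o invrM ?poch_unit //; apply: nnegM; apply: nneg_poch_inv.
by rewrite !unitrM !unitrV borwein_unit uo !uF.
Qed.

Lemma unit_coef0 (u : fps) : u 0%N = 1 -> u \is a GRing.unit.
Proof. by rewrite fps_unitE => ->; rewrite unitr1. Qed.

Lemma positive_dissect0 : positive dissect0.
Proof.
apply: positive_borwein_quotient.
  by apply: nnegM; apply: nneg_dil; [apply: nneg_psi | apply: nneg_phi].
by apply: unit_coef0; rewrite fcoefM0 !dilE.
Qed.

Lemma positive_dissect2 : positive dissect2.
Proof.
apply: positive_borwein_quotient.
  by apply: nnegM; [apply: nneg_phi | apply: nneg_dil; apply: nneg_psi].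
by apply: unit_coef0; rewrite fcoefM0 !dilE.
Qed.

Theorem theorem4p7 (n : nat) :
  [/\ 0 < a_coef (4 * n)%N,
      a_coef (4 * n + 1)%N < 0,
      a_coef (4 * n + 2)%N < 0
    & a_coef (4 * n + 3)%N = 0].
Proof.
(* The guards matter when [n = 0], where truncated subtraction could produce an index divisible by
   4. With them, at most one of the three terms survives in each residue class, and none for
   [r = 3]. *)
have E r : a_coef (4 * n + r)%N = dil 4 dissect0 (4 * n + r)%N
    - (if (4 * n + r < 2)%N then 0 else dil 4 dissect2 (4 * n + r - 2)%N)
    - 2 * (if (4 * n + r < 1)%N then 0 else dil 4 dissect1 (4 * n + r - 1)%N).
  rewrite a_coefE F1_F3_quotient !fcoefB.
  have -> v : (2 * v : fps) (4 * n + r)%N = 2 * v (4 * n + r)%N.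
    by rewrite mulr_natl fcoefD; ring.
  by rewrite -[q]expr1 -exprM !coef_qXM.
have h0 := positive_dissect0 n; have h1 := positive_dissect1 n; have h2 := positive_dissect2 n.
split.
- rewrite -[(4 * n)%N]addn0 E !dilE.
  by rewrite (_ : (4 * n + 0) %/ 4 = n)%N; [do !case: ifP; lia | lia].
- rewrite E !dilE.
  by rewrite (_ : (4 * n + 1 - 1) %/ 4 = n)%N; [do !case: ifP; lia | lia].
- rewrite E !dilE.
  by rewrite (_ : (4 * n + 2 - 2) %/ 4 = n)%N; [do !case: ifP; lia | lia].
- by rewrite E !dilE; do !case: ifP; lia.
Qed.
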